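(* For every $n\in\mathbb{N}$, the average resistance $M_n$ of all $n$-circuits lies between $1$ and $4.3954$: $$1\le M_n<4.3954 .$$
   Context: $\mathbb{N}=\{1,2,3,\dots\}$. Circuits are defined recursively and represented by ordered pairs of multisets. The unit circuit $(\{\},\{\})$ is a single unit resistor; it is considered to be both a series and a parallel circuit. A (non-unit) series circuit is a pair $(\{\alpha_1,\dots,\alpha_m\},\{\})$ where $\{\alpha_1,\dots,\alpha_m\}$ is a finite multiset of $m\ge 2$ parallel circuits (the unit circuit being allowed). A (non-unit) parallel circuit is a pair $(\{\},\{\beta_1,\dots,\beta_m\})$ where $\{\beta_1,\dots,\beta_m\}$ is a finite multiset of $m\ge 2$ series circuits (the unit circuit being allowed). Two circuits are the same iff these representations are equal. An $n$-circuit is a circuit containing exactly $n$ unit resistors (the unit circuit contains one; otherwise add the numbers in the sub-circuits). The resistance $r$ is defined by $r=1$ for the unit circuit, $r=\sum_i r(\alpha_i)$ for a series circuit with sub-circuits $\alpha_i$, and $r=\left(\sum_i r(\beta_i)^{-1}\right)^{-1}$ for a parallel circuit with sub-circuits $\beta_i$. $\Gamma_n$ is the (finite) set of all $n$-circuits, $Q_n=|\Gamma_n|$, $R_n=\sum_{\gamma\in\Gamma_n} r(\gamma)$, and $M_n=R_n/Q_n$. *)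

(* Defs.v *)
From HB Require Import structures.
From mathcomp Require Import all_boot all_order all_algebra.
From mathcomp Require Import finmap multiset.
From mathcomp Require Import boolp classical_sets functions cardinality.

Set Implicit Arguments.
Unset Strict Implicit.
Unset Printing Implicit Defensive.

Import Order.TTheory GRing.Theory Num.Theory.
Local Open Scope mset_scope.
Local Open Scope ring_scope.

(* Circuits are hereditary ordered pairs of finite multisets.  A multiset is
   encoded by the unique list of its elements that is sorted for a fixed
   arbitrary total order on trees, so that Leibniz equality of circuits is
   equality of the underlying pairs of multisets: see components below. *)
Inductive tree := Pair of seq tree & seq tree.

Fixpoint tree_encode (t : tree) : GenTree.tree void :=
  let: Pair s p := t in
  GenTree.Node 0 [:: GenTree.Node 0 (map tree_encode s);
                     GenTree.Node 0 (map tree_encode p)].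

Fixpoint tree_decode (g : GenTree.tree void) : tree :=
  match g with
  | GenTree.Node _ [:: GenTree.Node _ s; GenTree.Node _ p] =>
      Pair (map tree_decode s) (map tree_decode p)
  | _ => Pair [::] [::]
  end.

Lemma tree_encodeK : cancel tree_encode tree_decode.
Proof.
rewrite /cancel; fix IH 1 => -[s p] /=; congr Pair.
  by elim: s => //= x s ->; rewrite IH.
by elim: p => //= x p ->; rewrite IH.
Qed.

HB.instance Definition _ := Countable.copy tree (can_type tree_encodeK).

Definition tree_le : rel tree := fun t u => (choice.pickle t <= choice.pickle u)%N.

(* The unit circuit Pair [::] [::] is both a series and a parallel circuit. *)
Fixpoint series_tree (t : tree) : bool :=
  let: Pair s p := t in
  nilp p && (nilp s || [&& (2 <= size s)%N, sorted tree_le s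
                         & all parallel_tree s])
with parallel_tree (t : tree) : bool :=
  let: Pair s p := t in
  nilp s && (nilp p || [&& (2 <= size p)%N, sorted tree_le p
                         & all series_tree p]).

Definition circuit := {t : tree | series_tree t || parallel_tree t}.

Definition is_series (c : circuit) : bool := series_tree (val c).
Definition is_parallel (c : circuit) : bool := parallel_tree (val c).

Fixpoint tree_units (t : tree) : nat :=
  match t with
  | Pair [::] [::] => 1
  | Pair s p => sumn (map tree_units s) + sumn (map tree_units p)
  end.

(* On circuits at most one of the two lists is nonempty. *)
Fixpoint tree_resistance (t : tree) : rat :=
  match t with
  | Pair [::] [::] => 1
  | Pair s [::] => \sum_(x <- map tree_resistance s) x
  | Pair _ p => (\sum_(x <- map tree_resistance p) x^-1)^-1
  end.

Definition units (c : circuit) : nat := tree_units (val c).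
Definition resistance (c : circuit) : rat := tree_resistance (val c).

Definition Gamma (n : nat) : set circuit := [set c | units c = n]%classic.

(* fset_set A is the empty set when A is infinite; see finite_Gamma. *)
Definition Q (n : nat) : nat := #|` fset_set (Gamma n)|.
Definition R (n : nat) : rat := \sum_(c <- fset_set (Gamma n)) resistance c.
Definition M (n : nat) : rat := R n / (Q n)%:R.

Definition subcircuits (s : seq tree) : {mset circuit} := seq_mset (pmap insub s).

Definition components (c : circuit) : {mset circuit} * {mset circuit} :=
  let: Pair s p := val c in (subcircuits s, subcircuits p).

Lemma tree_le_total : total tree_le.
Proof. by move=> t u; apply: leq_total. Qed.

Lemma tree_le_trans : transitive tree_le.
Proof. by move=> t u v; apply: leq_trans. Qed.

Lemma tree_le_anti : antisymmetric tree_le.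
Proof. by move=> t u /anti_leq /(pcan_inj choice.pickleK). Qed.

Lemma val_pmap_insub (s : seq tree) :
  all (fun t => series_tree t || parallel_tree t) s ->
  map val (pmap insub s : seq circuit) = s.
Proof.
move=> /all_filterP as_; rewrite (pmap_filter (@insubK _ _ _)) -[RHS]as_.
by apply: eq_filter => t; rewrite isSome_insub.
Qed.

Lemma circuit_wf (c : circuit) (s p : seq tree) : val c = Pair s p ->
  [/\ all (fun t => series_tree t || parallel_tree t) s,
      all (fun t => series_tree t || parallel_tree t) p,
      sorted tree_le s & sorted tree_le p].
Proof.
have sub (a b : pred tree) r : (forall t, a t -> b t) -> all a r -> all b r.
  by move=> ab; apply: sub_all.
move: (valP c) => + e; rewrite e => /orP[] /= /andP[/nilP -> /orP[/nilP -> //|]];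
  move=> /and3P[_ so al]; split => //; apply: sub al => t ->; rewrite ?orbT //.
Qed.

Lemma components_inj : injective components.
Proof.
move=> c d; rewrite /components.
case ec: (val c) => [s p]; case ed: (val d) => [s' p'] [es ep].
have [a1 a2 a3 a4] := circuit_wf ec; have [b1 b2 b3 b4] := circuit_wf ed.
have key u v : all (fun t => series_tree t || parallel_tree t) u ->
    all (fun t => series_tree t || parallel_tree t) v ->
    sorted tree_le u -> sorted tree_le v ->
    subcircuits u = subcircuits v -> u = v.
  move=> au av su sv /eq_seq_msetP /(perm_map val).
  rewrite !val_pmap_insub //.
  exact: (sorted_eq tree_le_trans tree_le_anti).
by apply: val_inj; rewrite ec ed (key s s') // (key p p').
Qed.

Lemma perm_subcircuits (s : seq tree) :
  all (fun t => series_tree t || parallel_tree t) s ->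
  perm_eq (map val (subcircuits s)) s.
Proof.
move=> a; rewrite -[X in perm_eq _ X](val_pmap_insub a).
exact/perm_map/perm_eq_seq_mset.
Qed.

Lemma subcircuits_sort (A : {mset circuit}) :
  subcircuits (sort tree_le (map val A)) = A.
Proof.
rewrite /subcircuits -[RHS]seq_mset_id; apply/eq_seq_msetP.
apply: (perm_map_inj (@val_inj _ _ circuit)); rewrite val_pmap_insub; last first.
  by rewrite all_sort all_map; apply/allP => c _ /=; apply: (valP c).
exact/permPl/perm_sort.
Qed.

Lemma subcircuits0 : subcircuits [::] = mset0.
Proof. by apply/msetP => c; rewrite mset_seqE mset0E. Qed.

Lemma subcircuits_all (a : pred tree) (s : seq tree) :
  all (fun t => series_tree t || parallel_tree t) s ->
  all (fun c : circuit => a (val c)) (subcircuits s) = all a s.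
Proof. by move=> /perm_subcircuits/perm_all <-; rewrite all_map. Qed.

Lemma subcircuits_size (s : seq tree) :
  all (fun t => series_tree t || parallel_tree t) s ->
  size (subcircuits s) = size s.
Proof. by move=> /perm_subcircuits/perm_size <-; rewrite size_map. Qed.

Lemma seriesP (c : circuit) : is_series c <->
  components c = (mset0, mset0) \/
  exists A : {mset circuit},
    [/\ components c = (A, mset0), (2 <= size A)%N & all is_parallel A].
Proof.
rewrite /is_series /components; case ec: (val c) => [s p] /=.
have [a1 a2 _ _] := circuit_wf ec; split.
- move=> /andP[/nilP -> /orP[/nilP ->|/and3P[hs _ ha]]].
    by left; rewrite subcircuits0.
  right; exists (subcircuits s).
  by rewrite subcircuits0 subcircuits_size // subcircuits_all.
- have nil0 u : all (fun t => series_tree t || parallel_tree t) u ->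
      subcircuits u = mset0 -> u = [::].
    by move=> au eu; apply/nilP; rewrite /nilp -subcircuits_size // eu enum_mset0.
  case=> [[e1 e2]|[A [[e1 e2]]]]; first by rewrite (nil0 s) // (nil0 p).
  have [_ _ so _] := circuit_wf ec.
  rewrite (nil0 p) //= so -e1 subcircuits_size // subcircuits_all // => -> ->.
  by rewrite orbT.
Qed.

Lemma parallelP (c : circuit) : is_parallel c <->
  components c = (mset0, mset0) \/
  exists B : {mset circuit},
    [/\ components c = (mset0, B), (2 <= size B)%N & all is_series B].
Proof.
rewrite /is_parallel /components; case ec: (val c) => [s p] /=.
have [a1 a2 _ _] := circuit_wf ec; split.
- move=> /andP[/nilP -> /orP[/nilP ->|/and3P[hs _ ha]]].
    by left; rewrite subcircuits0.
  right; exists (subcircuits p).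
  by rewrite subcircuits0 subcircuits_size // subcircuits_all.
- have nil0 u : all (fun t => series_tree t || parallel_tree t) u ->
      subcircuits u = mset0 -> u = [::].
    by move=> au eu; apply/nilP; rewrite /nilp -subcircuits_size // eu enum_mset0.
  case=> [[e1 e2]|[B [[e1 e2]]]]; first by rewrite (nil0 s) // (nil0 p).
  have [_ _ _ so] := circuit_wf ec.
  rewrite (nil0 s) //= so -e2 subcircuits_size // subcircuits_all // => -> ->.
  by rewrite orbT.
Qed.

Lemma series_or_parallel (c : circuit) : is_series c || is_parallel c.
Proof. exact: (valP c). Qed.

Lemma unit_exists : exists c : circuit, components c = (mset0, mset0).
Proof.
have u : series_tree (Pair [::] [::]) || parallel_tree (Pair [::] [::]) by [].
by exists (Sub (Pair [::] [::]) u); rewrite /components /= subcircuits0.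
Qed.

Lemma series_exists (A : {mset circuit}) : (2 <= size A)%N ->
  all is_parallel A -> exists c : circuit, components c = (A, mset0).
Proof.
move=> hA pA; pose t := Pair (sort tree_le (map val A)) [::].
have wf : series_tree t || parallel_tree t.
  apply/orP; left; rewrite /= size_sort size_map hA sort_sorted ?all_sort ?all_map.
    by rewrite orbC; apply/orP; left.
  exact: tree_le_total.
by exists (Sub t wf); rewrite /components SubK /= subcircuits_sort subcircuits0.
Qed.

Lemma parallel_exists (B : {mset circuit}) : (2 <= size B)%N ->
  all is_series B -> exists c : circuit, components c = (mset0, B).
Proof.
move=> hB sB; pose t := Pair [::] (sort tree_le (map val B)).
have wf : series_tree t || parallel_tree t.
  apply/orP; right; rewrite /= size_sort size_map hB sort_sorted ?all_sort ?all_map.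
    by rewrite orbC; apply/orP; left.
  exact: tree_le_total.
by exists (Sub t wf); rewrite /components SubK /= subcircuits_sort subcircuits0.
Qed.

Lemma subcircuits_big (T : Type) (idx : T) (op : Monoid.com_law idx)
    (f : tree -> T) (s : seq tree) :
  all (fun t => series_tree t || parallel_tree t) s ->
  \big[op/idx]_(c <- subcircuits s) f (val c) = \big[op/idx]_(t <- s) f t.
Proof. by move=> /perm_subcircuits/(perm_big _) <-; rewrite big_map. Qed.

Lemma components_inv (c : circuit) (A B : {mset circuit}) :
  components c = (A, B) -> exists s p, [/\ val c = Pair s p,
    size A = size s, size B = size p, A = subcircuits s & B = subcircuits p].
Proof.
rewrite /components; case ec: (val c) => [s p] [<- <-]; exists s, p.
by have [a1 a2 _ _] := circuit_wf ec; rewrite !subcircuits_size.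
Qed.

Lemma units_unit (c : circuit) : components c = (mset0, mset0) -> units c = 1.
Proof.
move=> /components_inv [s [p [e]]]; rewrite enum_mset0 /units e.
by case: s e => // e; case: p e.
Qed.

Lemma units_series (c : circuit) (A : {mset circuit}) : (2 <= size A)%N ->
  components c = (A, mset0) -> units c = (\sum_(a <- A) units a)%N.
Proof.
move=> hA /components_inv [s [p [e e1 e2 -> _]]].
have [a1 _ _ _] := circuit_wf e.
rewrite subcircuits_big // /units e; case: s e1 {e a1} => [|x s] e1.
  by rewrite e1 in hA.
case: p e2 => [_|? ? /eqP]; last by rewrite enum_mset0.
by rewrite /= addn0 -[RHS](big_map tree_units xpredT id) -sumnE.
Qed.

Lemma units_parallel (c : circuit) (B : {mset circuit}) : (2 <= size B)%N ->
  components c = (mset0, B) -> units c = (\sum_(b <- B) units b)%N.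
Proof.
move=> hB /components_inv [s [p [e e1 e2 _ ->]]].
have [_ a2 _ _] := circuit_wf e.
rewrite subcircuits_big // /units e; case: p e2 {e a2} => [|x p] e2.
  by rewrite e2 in hB.
case: s e1 => [_|? ? /eqP]; last by rewrite enum_mset0.
by rewrite /= add0n -[RHS](big_map tree_units xpredT id) -sumnE.
Qed.

Lemma resistance_unit (c : circuit) :
  components c = (mset0, mset0) -> resistance c = 1.
Proof.
move=> /components_inv [s [p [e]]]; rewrite enum_mset0 /resistance e.
by case: s e => // e; case: p e.
Qed.

Lemma resistance_series (c : circuit) (A : {mset circuit}) : (2 <= size A)%N ->
  components c = (A, mset0) -> resistance c = \sum_(a <- A) resistance a.
Proof.
move=> hA /components_inv [s [p [e e1 e2 -> _]]].
have [a1 _ _ _] := circuit_wf e.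
rewrite subcircuits_big // /resistance e; case: s e1 {e a1} => [|x s] e1.
  by rewrite e1 in hA.
case: p e2 => [_|? ? /eqP]; last by rewrite enum_mset0.
by rewrite -[RHS](big_map tree_resistance xpredT id).
Qed.

Lemma resistance_parallel (c : circuit) (B : {mset circuit}) :
  (2 <= size B)%N -> components c = (mset0, B) ->
  resistance c = (\sum_(b <- B) (resistance b)^-1)^-1.
Proof.
move=> hB /components_inv [s [p [e e1 e2 _ ->]]].
have [_ a2 _ _] := circuit_wf e.
rewrite (subcircuits_big _ (fun t => (tree_resistance t)^-1)) //.
rewrite /resistance e; case: p e2 {e a2} => [|x p] e2; first by rewrite e2 in hB.
case: s e1 => [_|? ? /eqP]; last by rewrite enum_mset0.
by rewrite -[in RHS](big_map tree_resistance xpredT (fun y => y^-1)).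
Qed.

Lemma finite_Gamma (n : nat) : finite_set (Gamma n).
Proof.
pose wf t := series_tree t || parallel_tree t.
have upos t : (0 < tree_units t)%N.
  by move: t; fix IH 1 => -[[|x s] [|y p]] /=; rewrite ?addn_gt0 ?IH ?orbT.
pose fix lists (l : seq tree) k : seq (seq tree) :=
  if k is k'.+1 then
    [::] :: [seq x :: s | x <- l, s <- lists l k'] else [:: [::]].
have listsP l k s : (size s <= k)%N -> {subset s <= l} -> s \in lists l k.
  elim: k s => [|k IH] [|x s] //= sk sl.
  rewrite inE; apply/orP; right.
  apply/allpairsP; exists (x, s); split => //=; first by apply: sl; rewrite mem_head.
  by apply: IH => // y ys; apply: sl; rewrite inE ys orbT.
pose fix trees k : seq tree :=
  if k is k'.+1 then
    [seq Pair s [::] | s <- lists (trees k') k'.+1] ++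
    [seq Pair [::] p | p <- lists (trees k') k'.+1] else [::].
have sz s : (size s <= sumn (map tree_units s))%N.
  elim: s => //= x s IH.
  by rewrite -add1n leq_add.
have lt x s : x \in s -> (2 <= size s)%N ->
    (tree_units x < sumn (map tree_units s))%N.
  move=> xs; rewrite (perm_size (perm_to_rem xs)).
  rewrite (perm_sumn (perm_map tree_units (perm_to_rem xs))) /= => h.
  rewrite -[X in (X < _)%N]addn0 ltn_add2l.
  by apply: leq_trans (sz _); rewrite -ltnS.
have treesP k t : wf t -> (tree_units t <= k)%N -> t \in trees k.
  elim: k t => [|k IH] t; first by case: (tree_units t) (upos t).
  have step u : (2 <= size u)%N -> all wf u ->
      (sumn (map tree_units u) <= k.+1)%N -> u \in lists (trees k) k.+1.
    move=> hu au hk; apply: listsP; first exact: leq_trans (sz _) hk.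
    move=> x xu; apply: IH; first exact: (allP au).
    by rewrite -ltnS; apply: leq_trans hk; apply: lt.
  have nilL : [::] \in lists (trees k) k.+1 by [].
  have inS s : s \in lists (trees k) k.+1 -> Pair s [::] \in trees k.+1.
    by move=> h; rewrite mem_cat map_f.
  have inP p : p \in lists (trees k) k.+1 -> Pair [::] p \in trees k.+1.
    by move=> h; rewrite mem_cat; apply/orP; right; rewrite map_f.
  case: t => s p wft hk; case/orP: wft => /=.
  - move=> /andP[/nilP p0]; subst p; case/orP=> [/nilP ->|]; first exact: inS.
    move=> /and3P[hs _ al]; apply/inS/step => //.
      by apply: sub_all al => x; rewrite /wf => ->; rewrite orbT.
    by move: hk; case: s {al} hs => //= x s _; rewrite addn0.
  - move=> /andP[/nilP s0]; subst s; case/orP=> [/nilP ->|]; first exact: inP.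
    move=> /and3P[hs _ al]; apply/inP/step => //.
      by apply: sub_all al => x; rewrite /wf => ->.
    by move: hk; case: p {al} hs.
apply: (@sub_finite_set _ _ [set` (pmap insub (trees n) : seq circuit)]%classic);
  last exact: finite_seq.
move=> c /= cn; rewrite mem_pmap_sub; apply: treesP; first exact: (valP c).
by move: cn; rewrite /Gamma /units /= => ->.
Qed.

(* Main.v *)
Require Import Defs.
From mathcomp Require Import all_boot all_order all_algebra.
From mathcomp Require Import finmap multiset.
From mathcomp Require Import boolp classical_sets cardinality.
From mathcomp Require Import ring lra zify.

(** Exchanging series and parallel inverts resistances, so circuits of size n >= 2
    come in dual pairs of resistances r and 1/r, and r + 1/r >= 2 gives the lower bound.

    For the upper bound let a_n count the series n-circuits, and let S_n and P_n be the
    sums of their resistances and of the inverses (so that P_n sums over the parallel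
    n-circuits).  There are m_n = 2 a_n multisets of circuits of total size n >= 2.
    Removing a component from a multiset yields three convolution inequalities:
    - weighing a component by its size, sum_k k a_k m_(n-k) <= n m_n, hence
      sum_(0<k<n) a_k a_(n-k) <= a_n + a_(n-1);
    - S_n + P_n <= sum_k P_k m_(n-k) + 2 sum_k P_k m_(n-2k), the second sum accounting
      for repeated components;
    - P_n <= a_(n-1) + 1/2 sum_k [(S_k a_l + a_k (S_l + P_l))/4 + 7/20 a_k a_l]
             + 1/4 sum_(k<=n/2) S_k   with l = n - k.
    In the last one, a parallel circuit with a unit resistor has mean resistance exactly
    1/2, by pairing the remaining part with its dual; the other ones are split into a
    component and a rest, and the rest is again paired with its dual.
    The first inequality closes the induction P_n <= 11/5 a_n and S_n <= 261/40 a_n,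
    so that M_n = (S_n + P_n)/(2 a_n) <= 349/80 < 4.3954. *)

Set Implicit Arguments.
Unset Strict Implicit.
Unset Printing Implicit Defensive.

Import Order.TTheory GRing.Theory Num.Theory.
Local Open Scope mset_scope.
Local Open Scope ring_scope.

(** * The numerical induction *)

Section Recurrences.

Variables a m S P : nat -> rat.

Hypothesis a_ge0 : forall n, 0 <= a n.
Hypothesis a1 : a 1 = 1.
Hypothesis a2 : a 2 = 1.
Hypothesis m0 : m 0 = 1.
Hypothesis m1 : m 1 = 1.
Hypothesis mE : forall n, (2 <= n)%N -> m n = 2 * a n.
Hypothesis a_ge_m : forall n, (1 <= n)%N -> m n <= a n.+1.
Hypothesis pointing_le : forall n, \sum_(1 <= k < n.+1) k%:R * a k * m (n - k) <= n%:R * m n.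
Hypothesis P1 : P 1 = 1.
Hypothesis S_le_n : forall n, (2 <= n)%N -> S n <= n%:R * a n.
Hypothesis P_le_n : forall n, (2 <= n)%N -> P n <= n%:R / 4 * a n.
Hypothesis S_le_conv : forall n, (2 <= n)%N ->
  S n + P n <= \sum_(1 <= k < n.+1) P k * m (n - k)
               + 2 * \sum_(1 <= k < n./2.+1) P k * m (n - k.*2).
Hypothesis P_le_conv : forall n, (3 <= n)%N ->
  P n <= a n.-1
    + \sum_(2 <= k < n.-1) ((S k * a (n - k) + a k * (S (n - k) + P (n - k))) / 4
                            + 7 / 20 * (a k * a (n - k))) / 2
    + \sum_(2 <= k < n./2.+1) S k / 4.

Lemma a_double n : (2 <= n)%N -> 2 * a n <= a n.+1.
Proof. by move=> n2; rewrite -mE // a_ge_m // ltnW. Qed.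

Lemma a_le_succ n : (1 <= n)%N -> a n <= a n.+1.
Proof.
case: n => [//|[|n]] _; first by rewrite a1 a2.
by have := @a_double n.+2 isT; have := a_ge0 n.+2; lra.
Qed.

Lemma a_le i j : (1 <= i)%N -> (i <= j)%N -> a i <= a j.
Proof.
move=> i1 /subnKC <-; elim: (j - i)%N => [|d IH]; first by rewrite addn0.
by rewrite addnS; apply: le_trans IH (a_le_succ _); rewrite ltn_addr.
Qed.

Lemma a_double_iter n j : (2 <= n)%N -> 2 ^+ j * a n <= a (n + j).
Proof.
move=> n2; elim: j => [|j IH]; first by rewrite expr0 mul1r addn0.
rewrite exprS -mulrA addnS; apply: le_trans (a_double _); last by lia.
by rewrite ler_pM2l.
Qed.

Lemma conv_le n : (3 <= n)%N ->
  \sum_(1 <= k < n) a k * a (n - k) <= a n + a n.-1.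
Proof.
case: n => [//|n] n2 /=; set N := n.+1; set C := \sum_(1 <= k < N) _.
have rev : \sum_(1 <= k < N) k%:R * (a k * a (N - k))
         = \sum_(1 <= k < N) (N - k)%:R * (a k * a (N - k)).
  rewrite big_nat_rev /=; apply: eq_big_nat => k /andP[k1 kN].
  by rewrite add1n subSS subKn 1?ltnW // [a k * _]mulrC.
have E2 : 2 * \sum_(1 <= k < N) k%:R * (a k * a (N - k)) = N%:R * C.
  rewrite mulr_natl mulr2n {2}rev -big_split mulr_sumr /=; apply: eq_big_nat => k /andP[_ kN].
  by rewrite -mulrDl -natrD subnKC 1?ltnW.
have split_m : \sum_(1 <= k < N) k%:R * a k * m (N - k)
             = 2 * \sum_(1 <= k < N) k%:R * (a k * a (N - k)) - n%:R * a n.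
  rewrite /N !(big_nat_recr n) /=; try lia.
  rewrite subSnn m1 a1 mulrDr [in RHS]mulr_sumr.
  rewrite (eq_big_nat _ _ (F2 := fun k => 2 * (k%:R * (a k * a (n.+1 - k))))); first by ring.
  by move=> k /andP[k1 kn]; rewrite mE; [ring|lia].
have := pointing_le N; rewrite (big_nat_recr N) //= subnn m0 split_m E2 mE; last by lia.
have := a_ge0 n; rewrite /N -[n.+1]addn1 natrD.
have : (0 : rat) <= n%:R by [].
set x := n%:R; set u := a n; set v := a _ => x0 u0 h.
have x1 : 0 < x + 1 by lra.
rewrite -(ler_pM2l x1); lra.
Qed.

Lemma inner_conv_le n : (3 <= n)%N ->
  \sum_(2 <= k < n.-1) a k * a (n - k) <= a n - a n.-1.
Proof.
case: n => [|[|n]] // n1 /=; have := @conv_le n.+2 n1 => /=.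
rewrite big_nat_recr //= big_ltn //= subn1 subSnn a1 /=; lra.
Qed.

Lemma inner_sum_le (f : nat -> rat) (K : rat) n : (3 <= n)%N -> 0 <= K ->
  (forall k, (2 <= k < n.-1)%N -> f k <= K * (a k * a (n - k))) ->
  \sum_(2 <= k < n.-1) f k <= K * (a n - a n.-1).
Proof.
move=> n3 K0 fK; apply: le_trans (ler_sum_nat fK) _.
by rewrite -mulr_sumr ler_wpM2l // inner_conv_le.
Qed.

Lemma inner_term_le n k : (2 <= k < n.-1)%N -> a k * a (n - k) <= a n.
Proof.
move=> /andP[k2 kn]; have := @inner_conv_le n; rewrite (big_cat_nat _ (n := k)) //=; last by lia.
rewrite [\sum_(k <= _ < _) _]big_ltn //.
have s1 i j : 0 <= \sum_(i <= k < j) a k * a (n - k) by apply: sumr_ge0 => l _; rewrite mulr_ge0.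
have := s1 2 k; have := s1 k.+1 n.-1; have := a_ge0 n.-1.
set x := \sum_(_ <= _ < _) _; set y := \sum_(_ <= _ < _) _.
move=> ? ? ? h; have := h ltac:(lia); lra.
Qed.

Lemma a_mul_m_le n k : (3 <= k)%N -> (k.*2 <= n)%N ->
  a k * m (n - k.*2) <= 2 * a (n - k).
Proof.
move=> k3 kn.
have [->|[e|h]] : (n = k.*2 \/ n - k.*2 = 1 \/ 2 <= n - k.*2)%N by lia.
- by rewrite subnn m0 -addnn addnK; have := a_ge0 k; lra.
- rewrite e m1; have -> : (n - k = k.+1)%N by lia.
  by have := @a_double k ltac:(lia); have := a_ge0 k; lra.
rewrite mE //; have -> : a k * (2 * a (n - k.*2)) = 2 * (a k * a (n - k - k)).
  by rewrite -subnDA addnn; ring.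
by rewrite ler_pM2l // inner_term_le //; lia.
Qed.

Lemma weighted_tail_le n i : (i + 4 <= n)%N ->
  \sum_(3 <= k < i + 3) k%:R * a (n - k) <= 4 * a (n - 2) - (i + 4)%:R * a (n - (i + 2)).
Proof.
elim: i => [|i IH] h; first by rewrite big_geq // add0n; lra.
rewrite addSn big_nat_recr /=; last by lia.
have := IH ltac:(lia); have := @a_double (n - (i + 3)) ltac:(lia).
have -> : ((n - (i + 3)).+1 = n - (i + 2))%N by lia.
have -> : (i.+1 + 2 = i + 3)%N by lia.
rewrite -[i.+1]addn1 !natrD; have : (0 : rat) <= i%:R by [].
set x := i%:R; set u := a _; set v := a _ => x0 d; nra.
Qed.

Lemma sum_a_le n : (1 <= n)%N -> \sum_(2 <= k < n.+1) a k <= 2 * a n.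
Proof.
elim: n => [//|[|n] IH] _; first by rewrite big_geq // mulr_ge0.
rewrite big_nat_recr //=; have := IH isT; have := @a_le_succ n.+1 isT.
case: n IH => [|n] _; first by rewrite big_geq // a1 a2; lra.
by have := @a_double n.+2 isT; lra.
Qed.

Lemma S_step n : (7 <= n)%N ->
  (forall k, (2 <= k < n)%N -> P k <= 11 / 5 * a k) ->
  S n <= 261 / 40 * a n.
Proof.
move=> n7 IH; have := @S_le_conv n ltac:(lia).
rewrite big_nat_recr /=; last by lia.
rewrite subnn m0 mulr1.
set U := \sum_(1 <= k < n) _; set V := \sum_(1 <= k < _) _ => h.
have n1 : ((n - 1).+1 = n)%N by lia.
have n2 : ((n - 2).+1 = n - 1)%N by lia.
have n4 : (n - 4 + 4 = n)%N by lia.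
have d1 := @a_double (n - 1) ltac:(lia); have d2 := @a_double (n - 2) ltac:(lia).
have d4 := @a_double_iter (n - 4) 4 ltac:(lia).
rewrite n1 in d1; rewrite n2 in d2; rewrite n4 in d4.
have hU : U <= 22 / 5 * a n.
  rewrite /U big_ltn; last by lia.
  have e : n = n.-1.+1 by lia.
  rewrite [X in \sum_(2 <= _ < X) _]e big_nat_recr /=; last by lia.
  have -> : (n - n.-1 = 1)%N by lia.
  rewrite P1 m1 mE; last by lia.
  have := IH n.-1 ltac:(lia).
  have : \sum_(2 <= k < n.-1) P k * m (n - k) <= 22 / 5 * (a n - a n.-1).
    apply: inner_sum_le => [||k k2]; [by lia|by lra|].
    rewrite mE; last by lia.
    have hP := IH k ltac:(lia); have hm : 0 <= 2 * a (n - k) by rewrite mulr_ge0.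
    by have := ler_wpM2r hm hP; lra.
  rewrite subn1 in d1 *; have := a_ge0 n.-1; lra.
have hV : 2 * V <= 17 / 8 * a n.
  rewrite /V big_ltn ?(big_ltn (m := 2)); try lia.
  rewrite P1 !mE; try lia.
  have P2 := @P_le_n 2 isT; rewrite a2 in P2.
  have : \sum_(3 <= k < n./2.+1) P k * m (n - k.*2) <= 1 / 2 * a n.
    apply: le_trans (_ : \sum_(3 <= k < n./2.+1) 1 / 2 * (k%:R * a (n - k)) <= _).
      apply: ler_sum_nat => k kn; have k2 : (k.*2 <= n)%N by lia.
      have := @a_mul_m_le n k ltac:(lia) k2.
      have := @P_le_n k ltac:(lia).
      have : 0 <= m (n - k.*2).
        case: (n - k.*2)%N => [|[|i]]; rewrite ?m0 ?m1 //.
        by rewrite mE // mulr_ge0.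
      have : (0 : rat) <= k%:R by [].
      set x := k%:R; set u := m _; set v := a k; set w := a _ => x0 u0 hP hm.
      apply: le_trans (_ : x / 4 * v * u <= _); first by rewrite ler_wpM2r.
      by have := ler_wpM2l x0 hm; lra.
    rewrite -mulr_sumr; have e : (n./2.+1 = n./2 - 2 + 3)%N by lia.
    have := @weighted_tail_le n (n./2 - 2) ltac:(lia); rewrite -e.
    have : 0 <= (n./2 - 2 + 4)%:R * a (n - (n./2 - 2 + 2)) by rewrite mulr_ge0.
    lra.
  rewrite !doubleS double0.
  by have := ler_wpM2r (a_ge0 (n - 4)) P2; lra.
lra.
Qed.

Lemma P_step n : (9 <= n)%N ->
  (forall k, (2 <= k < n)%N -> P k <= 11 / 5 * a k /\ S k <= 261 / 40 * a k) ->
  P n <= 11 / 5 * a n.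
Proof.
move=> n9 IH; apply: le_trans (@P_le_conv n ltac:(lia)) _.
set U := \sum_(2 <= k < n.-1) _; set V := \sum_(2 <= k < _) _.
have hU : U <= 333 / 160 * (a n - a n.-1).
  apply: inner_sum_le => [||k k2]; [by lia|by lra|].
  have [_ sk] := IH k ltac:(lia); have [pl sl] := IH (n - k)%N ltac:(lia).
  have := ler_wpM2r (a_ge0 (n - k)) sk.
  have : S (n - k) + P (n - k) <= 349 / 40 * a (n - k) by lra.
  by move/(ler_wpM2l (a_ge0 k)); lra.
have hV : V <= 261 / 80 * a n./2.
  apply: le_trans (_ : \sum_(2 <= k < n./2.+1) 261 / 160 * a k <= _).
    by apply: ler_sum_nat => k kn; have [_ ?] := IH k ltac:(lia); lra.
  by rewrite -mulr_sumr; have := @sum_a_le n./2 ltac:(lia); lra.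
have : 2 ^+ 5 * a n./2 <= a n.
  apply: le_trans (@a_double_iter n./2 5 _) _; first by lia.
  by apply: a_le; lia.
have := a_ge0 n.-1; have := a_ge0 n; lra.
Qed.

Lemma resistance_sums_le n : (2 <= n)%N ->
  P n <= 11 / 5 * a n /\ S n <= 261 / 40 * a n.
Proof.
elim/ltn_ind: n => n IH n2.
have IH' k : (2 <= k < n)%N -> P k <= 11 / 5 * a k /\ S k <= 261 / 40 * a k.
  by move=> /andP[? ?]; apply: IH.
have an := a_ge0 n.
split.
  case: (leqP 9 n) => [n9|n9]; first exact: P_step.
  apply: le_trans (P_le_n n2) (ler_wpM2r an _).
  have : n%:R <= 8%:R :> rat by rewrite ler_nat.
  lra.
case: (leqP 7 n) => [n7|n7].
  by apply: (S_step n7) => k /IH' [hk _]; exact: hk.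
apply: le_trans (S_le_n n2) (ler_wpM2r an _).
have : n%:R <= 6%:R :> rat by rewrite ler_nat.
lra.
Qed.

End Recurrences.

(** * Multisets of trees *)

Lemma ler_sum_seq (T : eqType) (R : numDomainType) (s : seq T) (f g : T -> R) :
  (forall x, x \in s -> f x <= g x) -> \sum_(x <- s) f x <= \sum_(x <- s) g x.
Proof. by move=> fg; rewrite big_seq [leRHS]big_seq ler_sum. Qed.

Section SeqSums.

Variables (T : eqType) (R : numDomainType).

Lemma ler_sum_subset (s t : seq T) (f : T -> R) : uniq s -> uniq t ->
  {subset s <= t} -> (forall x, x \in t -> 0 <= f x) ->
  \sum_(x <- s) f x <= \sum_(x <- t) f x.
Proof.
move=> us ut st f0; rewrite [leRHS](bigID [in s]) /= -[leLHS]addr0 lerD //; last first.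
  by rewrite big_seq_cond sumr_ge0 // => x /andP[/f0].
rewrite -[leRHS]big_filter le_eqVlt; apply/orP/or_introl/eqP.
apply/perm_big/uniq_perm; rewrite ?filter_uniq //.
by move=> x; rewrite mem_filter andb_idr // => /st.
Qed.

Lemma ler_sum_inj (U : eqType) (s : seq U) (t : seq T) (h : U -> T)
    (g : U -> R) (f : T -> R) : uniq s -> uniq t -> {in s &, injective h} ->
  (forall u, u \in s -> h u \in t) -> (forall u, u \in s -> g u <= f (h u)) ->
  (forall x, x \in t -> 0 <= f x) -> \sum_(u <- s) g u <= \sum_(x <- t) f x.
Proof.
move=> us ut hi hst gf f0; apply: (@le_trans _ _ (\sum_(x <- map h s) f x)).
  by rewrite big_map; apply: ler_sum_seq => u /gf.
by apply: ler_sum_subset; rewrite ?map_inj_in_uniq // => x /mapP[u us' ->]; apply: hst.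
Qed.

Lemma sumr_cst (s : seq T) (c : R) : \sum_(x <- s) c = c * (size s)%:R.
Proof. by rewrite big_const_seq count_predT iter_addr_0 mulr_natr. Qed.

Lemma sumr_1 (s : seq T) : \sum_(x <- s) (1 : R) = (size s)%:R.
Proof. by rewrite sumr_cst mul1r. Qed.

End SeqSums.

Section MsetSums.

Variable T : choiceType.
Implicit Types (x : T) (A B : {mset T}).

Lemma perm_msetD A B : perm_eq (A `+` B) (A ++ B).
Proof. by apply/allP => x _; rewrite /= count_cat !count_mem_mset msetE2. Qed.

Lemma perm_mset1D x A : perm_eq (x +` A) (x :: A).
Proof. by apply: perm_trans (perm_msetD _ _) _; rewrite enum_msetn. Qed.

Lemma size_mset1D x A : size (x +` A) = (size A).+1.
Proof. exact: perm_size (perm_mset1D x A). Qed.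

Lemma sumr_undup_mset (R : nmodType) A (f : T -> R) :
  \sum_(x <- A) f x = \sum_(x <- undup A) f x *+ A x.
Proof.
rewrite -big_undup_iterop_count; apply: eq_bigr => x _.
by rewrite Monoid.iteropE count_mem_mset iter_addr_0.
Qed.

Lemma mset_size_neq0P A : (size A != 0)%N -> exists x B, A = x +` B.
Proof.
rewrite size_mset_eq0 => A0; case: (mset_0Vmem A) A0 => [->|[x xA] _]; first by rewrite eqxx.
by exists x, (A `\ x); rewrite msetB1K.
Qed.

Lemma mset_size1P A : size A = 1%N -> exists x, A = [mset x].
Proof.
move=> sA; have [x [B eA]] := @mset_size_neq0P A ltac:(by rewrite sA); exists x.
by move: sA; rewrite {}eA size_mset1D => -[/eqP]; rewrite size_mset_eq0 => /eqP ->; rewrite msetD0.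
Qed.

Lemma mset_size_ge2P A : (2 <= size A)%N -> exists x y B, A = x +` (y +` B).
Proof.
move=> sA; have [x [B eA]] := @mset_size_neq0P A ltac:(by case: (size A) sA).
move: sA; rewrite {}eA size_mset1D => sB.
by have [y [C ->]] := @mset_size_neq0P B ltac:(by case: (size B) sB); exists x, y, C.
Qed.

End MsetSums.

Section MultisetTrees.

Variables (T : choiceType) (leaf : T) (kids : T -> {mset T}).
Variables (wt : T -> nat) (rho : T -> rat) (E : nat -> seq T).
Implicit Types (x y : T) (A B : {mset T}) (n : nat).

Hypothesis kids_inj : injective kids.
Hypothesis size_kids : forall x, (size (kids x) != 1)%N.
Hypothesis kids_surj : forall A : {mset T}, (size A != 1)%N -> exists x, kids x = A.
Hypothesis kids_leaf : kids leaf = mset0.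
Hypothesis wt_gt0 : forall x, (0 < wt x)%N.
Hypothesis wt_leaf : wt leaf = 1%N.
Hypothesis wt_kids : forall x, x != leaf -> wt x = (\sum_(y <- kids x) wt y)%N.
Hypothesis rho_leaf : rho leaf = 1.
Hypothesis rho_kids : forall x, x != leaf -> rho x = \sum_(y <- kids x) (rho y)^-1.
Hypothesis uniq_E : forall n, uniq (E n).
Hypothesis mem_E : forall n x, (x \in E n) = (wt x == n).

Definition mwt (A : {mset T}) : nat := (\sum_(x <- A) wt x)%N.
Definition cond (A : {mset T}) : rat := \sum_(x <- A) (rho x)^-1.

Definition msets (n : nat) : seq {mset T} :=
  if n is 0 then [:: mset0] else
  [seq [mset x] | x <- E n] ++ [seq kids x | x <- E n & x != leaf].

Lemma mwt0 : mwt mset0 = 0%N. Proof. by rewrite /mwt enum_mset0 big_nil. Qed.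
Lemma cond0 : cond mset0 = 0. Proof. by rewrite /cond enum_mset0 big_nil. Qed.

Lemma mwt1D x A : mwt (x +` A) = (wt x + mwt A)%N.
Proof. by rewrite /mwt (perm_big _ (perm_mset1D x A)) big_cons. Qed.

Lemma cond1D x A : cond (x +` A) = (rho x)^-1 + cond A.
Proof. by rewrite /cond (perm_big _ (perm_mset1D x A)) big_cons. Qed.

Lemma mwt1 x : mwt [mset x] = wt x.
Proof. by rewrite -[[mset x]]msetD0 mwt1D mwt0 addn0. Qed.

Lemma cond1 x : cond [mset x] = (rho x)^-1.
Proof. by rewrite -[[mset x]]msetD0 cond1D cond0 addr0. Qed.

Lemma kids_size_ge2 x : x != leaf -> (2 <= size (kids x))%N.
Proof.
move=> xl; case e: (size (kids x)) (size_kids x) => [|[|//]] // _.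
by move/eqP: e; rewrite size_mset_eq0 -kids_leaf (inj_eq kids_inj) (negPf xl).
Qed.

Lemma kids_of (A : {mset T}) : (2 <= size A)%N -> exists2 x, x != leaf & kids x = A.
Proof.
move=> sA; have [x xA] := @kids_surj A ltac:(by case: (size A) sA => [|[]]).
by exists x => //; apply: contraTneq sA => xl; rewrite -xA xl kids_leaf size_mset0.
Qed.

Lemma mwt_eq0 A : (mwt A == 0)%N = (A == mset0).
Proof.
apply/idP/eqP => [|->]; last by rewrite mwt0.
apply: contraTeq; rewrite -size_mset_eq0 => /mset_size_neq0P[x [B ->]].
by rewrite mwt1D; have := wt_gt0 x; lia.
Qed.

Lemma mem_msets n A : (A \in msets n) = (mwt A == n).
Proof.
case: n => [|n]; first by rewrite inE mwt_eq0.
rewrite mem_cat; apply/orP/eqP => [[/mapP[x xn ->]|/mapP[x xn ->]]|wA].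
- by move: xn; rewrite mem_E mwt1 => /eqP.
- by move: xn; rewrite mem_filter mem_E => /andP[xl /eqP <-]; rewrite wt_kids.
have : (size A != 0)%N by rewrite size_mset_eq0 -mwt_eq0 wA.
case e: (size A) => [//|[|s]] _.
  have [x eA] := mset_size1P e; left; apply/mapP; exists x => //.
  by rewrite mem_E -wA eA mwt1.
have [x xl xA] := @kids_of A ltac:(by rewrite e).
by right; apply/mapP; exists x => //; rewrite mem_filter xl mem_E wt_kids // xA -wA eqxx.
Qed.

Lemma uniq_msets n : uniq (msets n).
Proof.
case: n => [//|n]; rewrite cat_uniq !map_inj_uniq ?filter_uniq ?uniq_E //=; last first.
  exact: (msetn_inj (n := 1)).
rewrite andbT -all_predC; apply/allP => A /mapP[x _ ->]; apply/mapP => -[y _ e].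
by have := size_kids x; rewrite e enum_msetn.
Qed.

Lemma wt_eq1 x : (wt x == 1)%N = (x == leaf).
Proof.
apply/idP/eqP => [|->]; last by rewrite wt_leaf.
apply: contraTeq => xl; have [y [z [B e]]] := mset_size_ge2P (kids_size_ge2 xl).
rewrite wt_kids // -/(mwt _) e !mwt1D.
by have := wt_gt0 y; have := wt_gt0 z; lia.
Qed.

Lemma wt_neq_leaf n x : (2 <= n)%N -> x \in E n -> x != leaf.
Proof. by move=> n2; rewrite mem_E -wt_eq1 => /eqP ->; case: n n2 => [|[]]. Qed.

Lemma E1 : E 1 = [:: leaf].
Proof.
apply: perm_small_eq => //; apply: uniq_perm => // x.
by rewrite mem_E wt_eq1 inE.
Qed.

Definition wt_range i j : seq T := [seq x | k <- index_iota i j, x <- E k].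

Lemma mem_wt_range i j x : (x \in wt_range i j) = (i <= wt x < j)%N.
Proof.
apply/allpairsPdep/idP => [[k [y [+ + ->]]]|xij].
  by rewrite mem_index_iota mem_E => kn /eqP ->.
by exists (wt x), x; rewrite mem_index_iota mem_E.
Qed.

Lemma uniq_wt_range i j : uniq (wt_range i j).
Proof.
apply: allpairs_uniq_dep; rewrite ?iota_uniq // => u v.
move=> /allpairsPdep[k [x [_ + ->]]] /allpairsPdep[l [y [_ + ->]]] /=.
by rewrite !mem_E => /eqP <- /eqP <- ->.
Qed.

Section BigMsets.
Variables (R : nmodType).

Lemma big_msets (F : {mset T} -> R) n : (2 <= n)%N ->
  \sum_(A <- msets n) F A = \sum_(x <- E n) (F [mset x] + F (kids x)).
Proof.
case: n => // n n2; rewrite big_cat !big_map big_filter big_split /=; congr (_ + _).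
by rewrite big_seq_cond [RHS]big_seq; apply: eq_bigl => x; apply: andb_idr => /(wt_neq_leaf n2).
Qed.

Lemma big_msets_ge2 (F : {mset T} -> R) n : (2 <= n)%N ->
  \sum_(A <- msets n | (2 <= size A)%N) F A = \sum_(x <- E n) F (kids x).
Proof.
move=> n2; rewrite big_mkcond big_msets // big_seq [RHS]big_seq; apply: eq_bigr => x xn.
by rewrite enum_msetn /= add0r kids_size_ge2 // (wt_neq_leaf n2).
Qed.

Lemma big_msets_mem (F : {mset T} -> R) n x : (wt x <= n)%N ->
  \sum_(A <- msets n | x \in A) F A = \sum_(A <- msets (n - wt x)) F (x +` A).
Proof.
move=> xn; rewrite -[RHS](big_map (fun A => x +` A) xpredT) -[LHS]big_filter.
apply/perm_big/uniq_perm; rewrite ?filter_uniq ?map_inj_uniq ?uniq_msets //.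
  by move=> B C e; rewrite -(msetD1K x B) e msetD1K.
move=> A; rewrite mem_filter mem_msets; apply/andP/mapP => [[xA /eqP wA]|[B + ->]].
  exists (A `\ x); rewrite ?msetB1K // mem_msets -wA -{2}(msetB1K xA).
  by rewrite mwt1D addKn.
by rewrite mem_msets mset1D1 mwt1D => /eqP ->; rewrite subnKC.
Qed.

(* Double counting of the pairs (A, x) with x in A: removing one copy of x from A
   leaves an arbitrary multiset of the complementary weight. *)
Lemma big_msets_pointed (F : T -> {mset T} -> R) n :
  \sum_(A <- msets n) \sum_(x <- undup A) F x A
  = \sum_(1 <= k < n.+1) \sum_(x <- E k) \sum_(A <- msets (n - k)) F x (x +` A).
Proof.
transitivity (\sum_(A <- msets n) \sum_(x <- wt_range 1 n.+1 | x \in A) F x A).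
  apply: eq_big_seq => A; rewrite mem_msets => /eqP wA; rewrite -[RHS]big_filter.
  apply/perm_big/uniq_perm; rewrite ?undup_uniq ?filter_uniq ?uniq_wt_range // => x.
  rewrite mem_undup mem_filter mem_wt_range wt_gt0 ltnS andb_idr // => xA.
  by rewrite -wA -(msetB1K xA) mwt1D leq_addr.
under eq_bigr do rewrite big_mkcond.
rewrite exchange_big /= big_allpairs_dep; apply: eq_big_nat => k /andP[_ kn].
apply: eq_big_seq => x; rewrite mem_E => /eqP wx.
by rewrite -big_mkcond big_msets_mem wx.
Qed.

End BigMsets.

Definition card_of_wt n : rat := (size (E n))%:R.
Definition msets_card n : rat := (size (msets n))%:R.
Definition series_sum n : rat := \sum_(x <- E n) rho x.
Definition parallel_sum n : rat := \sum_(x <- E n) (rho x)^-1.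

Local Notation a := card_of_wt.
Local Notation m := msets_card.
Local Notation S := series_sum.
Local Notation P := parallel_sum.

Lemma msets_card_sum n : m n = \sum_(A <- msets n) 1.
Proof. by rewrite sumr_1. Qed.

Lemma card_of_wt_sum n : a n = \sum_(x <- E n) 1.
Proof. by rewrite sumr_1. Qed.

Lemma card_ge0 n : 0 <= a n. Proof. exact: ler0n. Qed.

Lemma msets_card0 : m 0 = 1. Proof. by []. Qed.

Lemma card1 : a 1 = 1. Proof. by rewrite /a E1. Qed.

Lemma msets_card1 : m 1 = 1.
Proof. by rewrite /m /= E1 /= eqxx. Qed.

Lemma msets_cardE n : (2 <= n)%N -> m n = 2 * a n.
Proof. by move=> n2; rewrite msets_card_sum big_msets // big_split /= -card_of_wt_sum; ring. Qed.

Lemma big_msets_leaf (F : {mset T} -> rat) n :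
  \sum_(A <- msets n.+1 | leaf \in A) F A = \sum_(A <- msets n) F (leaf +` A).
Proof. by rewrite big_msets_mem wt_leaf // subn1. Qed.

Lemma card_with_leaf n : (1 <= n)%N ->
  m n = \sum_(x <- E n.+1) (leaf \in kids x)%:R.
Proof.
move=> n1; rewrite msets_card_sum -(big_msets_leaf (fun=> 1)) big_mkcond big_msets //.
apply: eq_big_seq => x /(@wt_neq_leaf n.+1 x n1) xl.
by rewrite in_mset1 eq_sym (negPf xl) add0r; case: ifP.
Qed.

Lemma msets_card_le n : (1 <= n)%N -> m n <= a n.+1.
Proof.
by move=> n1; rewrite card_with_leaf // card_of_wt_sum; apply: ler_sum => x _; case: (_ \in _).
Qed.

Lemma card2 : a 2 = 1.
Proof.
rewrite -msets_card1 card_with_leaf // card_of_wt_sum; apply: eq_big_seq => x x2.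
have xl := wt_neq_leaf (isT : 1 < 2)%N x2.
have [y [z [B e]]] := mset_size_ge2P (kids_size_ge2 xl).
have : wt x = 2%N by apply/eqP; rewrite -mem_E.
rewrite wt_kids // -/(mwt _) e !mwt1D; have := wt_gt0 y; have := wt_gt0 z => z0 y0 w.
have /eqP : (wt y == 1)%N by lia.
by move=> /eqP; rewrite wt_eq1 => /eqP ->; rewrite mset1D1.
Qed.

Lemma pointing_le n : \sum_(1 <= k < n.+1) k%:R * a k * m (n - k) <= n%:R * m n.
Proof.
have -> : \sum_(1 <= k < n.+1) k%:R * a k * m (n - k)
        = \sum_(A <- msets n) \sum_(x <- undup A) (wt x)%:R.
  rewrite (big_msets_pointed (fun x _ => (wt x)%:R)); apply: eq_bigr => k _.
  rewrite card_of_wt_sum -mulrA mulr_suml mulr_sumr; apply: eq_big_seq => x.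
  rewrite mem_E => /eqP ->; rewrite msets_card_sum mulr_sumr mul1r mulr_sumr.
  by apply: eq_bigr => A _; rewrite mulr1.
rewrite msets_card_sum mulr_sumr; apply: ler_sum_seq => A; rewrite mem_msets mulr1 => /eqP <-.
rewrite /mwt natr_sum sumr_undup_mset; apply: ler_sum_seq => x; rewrite mem_undup.
by rewrite -mset_gt0 => xA; rewrite -[leRHS]mulr_natr ler_peMr // ler1n.
Qed.

Lemma wt_kids_lt x y : x != leaf -> y \in kids x -> (wt y < wt x)%N.
Proof.
move=> xl yx; rewrite (wt_kids xl) -/(mwt _) -(msetB1K yx) mwt1D.
have := mwt_eq0 (kids x `\ y); case: (mwt _) => [|i _]; last by lia.
rewrite eqxx => /esym/eqP e; have := kids_size_ge2 xl.
by rewrite -(msetB1K yx) e size_mset1D size_mset0.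
Qed.

Lemma rho_gt0 x : 0 < rho x.
Proof.
have [n] := ubnP (wt x); elim: n x => // n IH x xn.
have [->|xl] := eqVneq x leaf; first by rewrite rho_leaf.
have pos y : y \in kids x -> 0 < (rho y)^-1.
  by move=> yx; rewrite invr_gt0 IH //; have := wt_kids_lt xl yx; lia.
have [y [B e]] := @mset_size_neq0P _ (kids x) ltac:(by have := kids_size_ge2 xl; case: size).
rewrite rho_kids // -/(cond _) e cond1D ltr_pwDl ?pos ?e ?mset1D1 //.
rewrite /cond big_seq sumr_ge0 // => z zB; rewrite ltW // pos // e.
exact: mset1Dr.
Qed.

Lemma cond_ge0 A : 0 <= cond A.
Proof. by apply: sumr_ge0 => x _; rewrite invr_ge0 ltW ?rho_gt0. Qed.

Lemma rho_bounds x : rho x <= (wt x)%:R /\ (x != leaf -> (rho x)^-1 <= (wt x)%:R / 4).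
Proof.
have [n] := ubnP (wt x); elim: n x => // n IH x xn.
have [->|xl] := eqVneq x leaf; first by rewrite rho_leaf wt_leaf.
have lt y : y \in kids x -> (wt y < n)%N by move=> /(wt_kids_lt xl); lia.
have wR : (wt x)%:R = \sum_(y <- kids x) (wt y)%:R :> rat by rewrite wt_kids // natr_sum.
split=> [|_].
  rewrite rho_kids // wR; apply: ler_sum_seq => y yx.
  have [_] := IH y (lt y yx); have [->|yl] := eqVneq y leaf.
    by rewrite rho_leaf wt_leaf invr1.
  move=> /(_ isT) h; apply: le_trans h _; have : (0 : rat) <= (wt y)%:R by []; lra.
have [y [z [B e]]] := mset_size_ge2P (kids_size_ge2 xl).
have [ry _] := IH y (lt y ltac:(by rewrite e mset1D1)).
have [rz _] := IH z (lt z ltac:(by rewrite e mset1Dr // mset1D1)).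
have hw : (wt y)%:R + (wt z)%:R <= (wt x)%:R :> rat.
  by rewrite -natrD ler_nat (wt_kids xl) -/(mwt _) e !mwt1D; lia.
have hr : (rho y)^-1 + (rho z)^-1 <= rho x.
  by rewrite [leRHS]rho_kids // -/(cond _) e !cond1D; have := cond_ge0 B; lra.
have := rho_gt0 x; have := rho_gt0 y; have := rho_gt0 z.
move: hw hr ry rz; set p := rho y; set q := rho z; set r := rho x; set w := (wt x)%:R.
move=> hw hr ry rz q0 p0 r0.
rewrite -[X in X <= _]mul1r ler_pdivrMr //.
have hpq : p + q <= w by lra.
have w0 : 0 < w by lra.
have : 4 <= (p + q) * (p^-1 + q^-1).
  have -> : (p + q) * (p^-1 + q^-1) = 4 + (p - q) ^+ 2 / (p * q).
    by field; rewrite !gt_eqF.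
  by rewrite lerDl divr_ge0 ?sqr_ge0 // mulr_ge0 // ltW.
have : (p + q) * (p^-1 + q^-1) <= w * r.
  by apply: ler_pM => //; rewrite ?addr_ge0 ?invr_ge0 ?ltW.
lra.
Qed.

Lemma parallel_sum1 : P 1 = 1.
Proof. by rewrite /P E1 big_seq1 rho_leaf invr1. Qed.

Lemma series_sum_le n : (2 <= n)%N -> S n <= n%:R * a n.
Proof.
move=> n2; rewrite card_of_wt_sum mulr_sumr; apply: ler_sum_seq => x.
rewrite mem_E mulr1 => /eqP <-.
by have [] := rho_bounds x.
Qed.

Lemma parallel_sum_le n : (2 <= n)%N -> P n <= n%:R / 4 * a n.
Proof.
move=> n2; rewrite card_of_wt_sum mulr_sumr; apply: ler_sum_seq => x xn; rewrite mulr1.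
have [_] := rho_bounds x; rewrite (wt_neq_leaf n2 xn) => /(_ isT).
by move: xn; rewrite mem_E => /eqP ->.
Qed.

Lemma msets_card_double n : (1 <= n)%N -> 2 * m n <= m n.+1.
Proof. by move=> n1; rewrite [leRHS]msets_cardE // ler_pM2l // msets_card_le. Qed.

Lemma msets_card_ge0 n : 0 <= m n. Proof. exact: ler0n. Qed.

Lemma msets_card_le_add n i : m n <= m (n + i).
Proof.
elim: i => [|i IH]; first by rewrite addn0.
rewrite addnS; apply: le_trans IH _; case: (n + i)%N => [|j]; first by rewrite msets_card1.
by have := @msets_card_double j.+1 isT; have := msets_card_ge0 j.+1; lra.
Qed.

Lemma msets_card_double_add n i : (2 <= i)%N -> 2 * m n <= m (n + i).
Proof.
case: n => [|n] i2.
  have -> : 2 * m 0 = m 2 by rewrite [RHS]msets_cardE // card2.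
  by rewrite -(subnKC i2) add0n msets_card_le_add.
apply: le_trans (@msets_card_double n.+1 isT) _; case: i i2 => // i _.
by rewrite addnS -addSn msets_card_le_add.
Qed.

Definition occurrences x n : rat := \sum_(A <- msets n) (A x)%:R.

Lemma occurrences_lt x n : (n < wt x)%N -> occurrences x n = 0.
Proof.
move=> nx; have nA A : A \in msets n -> A x = 0%N.
  rewrite mem_msets => /eqP wA; apply/mset_eq0P; apply: contraL nx => xA.
  by rewrite -wA -(msetB1K xA) mwt1D -leqNgt leq_addr.
by rewrite /occurrences big_seq big1 // => A /nA ->.
Qed.

Lemma occurrences_rec x n : (wt x <= n)%N ->
  occurrences x n = m (n - wt x) + occurrences x (n - wt x).
Proof.
move=> xn; rewrite /occurrences (bigID (fun A : {mset T} => x \in A)) /=.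
rewrite [X in _ + X]big1 ?addr0; last by move=> A /mset_eq0P ->.
rewrite (big_msets_mem (fun A => (A x)%:R)) // msets_card_sum -big_split /=.
by apply: eq_bigr => A _; rewrite mset1DE eqxx natrD.
Qed.

Lemma occurrences_le x n : (wt x <= n)%N -> occurrences x n <= 2 * m (n - wt x).
Proof.
elim/ltn_ind: n => n IH xn; rewrite occurrences_rec //.
have x0 := wt_gt0 x.
suff : occurrences x (n - wt x) <= m (n - wt x) by lra.
have [h|h] := ltnP (n - wt x) (wt x); first by rewrite occurrences_lt.
have [e|ne] := eqVneq (n - wt x)%N 1%N.
  have x1 : wt x = 1%N by lia.
  by rewrite e occurrences_rec x1 // subnn occurrences_lt ?x1 // addr0 msets_card1.
apply: le_trans (IH _ _ h) _; first by lia.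
set k := (n - wt x - wt x)%N; have -> : (n - wt x = k + wt x)%N by rewrite /k; lia.
have [x2|x2] := leqP 2 (wt x); first exact: msets_card_double_add.
have -> : wt x = 1%N by lia.
by rewrite addn1 msets_card_double // /k; lia.
Qed.

Lemma series_parallel_sum n : (2 <= n)%N -> S n + P n = \sum_(A <- msets n) cond A.
Proof.
move=> n2; rewrite big_msets // -big_split /=; apply: eq_big_seq => x /(wt_neq_leaf n2) xl.
by rewrite cond1 /cond -rho_kids // addrC.
Qed.

Lemma series_sum_le_conv n : (2 <= n)%N ->
  S n + P n <= \sum_(1 <= k < n.+1) P k * m (n - k)
               + 2 * \sum_(1 <= k < n./2.+1) P k * m (n - k.*2).
Proof.
move=> n2; rewrite series_parallel_sum //.
under eq_bigr do rewrite /cond sumr_undup_mset.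
rewrite (big_msets_pointed (fun x A => (rho x)^-1 *+ A x)).
have -> : \sum_(1 <= k < n.+1) \sum_(x <- E k) \sum_(A <- msets (n - k)) (rho x)^-1 *+ (x +` A) x
  = \sum_(1 <= k < n.+1) (P k * m (n - k)
                          + \sum_(x <- E k) (rho x)^-1 * occurrences x (n - k)).
  apply: eq_bigr => k _; rewrite mulr_suml -big_split /=; apply: eq_bigr => x _.
  rewrite -mulrDr msets_card_sum -big_split mulr_sumr; apply: eq_bigr => A _ /=.
  by rewrite mset1DE eqxx -[LHS]mulr_natr natrD.
rewrite big_split lerD2l /= (big_cat_nat _ (n := n./2.+1)) //=; last by lia.
rewrite [X in _ + X]big_nat_cond [X in _ + X]big1 ?addr0; last first.
  move=> k /andP[/andP[k1 k2] _]; apply: big1_seq => x /andP[_]; rewrite mem_E => /eqP xk.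
  by rewrite occurrences_lt ?mulr0 //; lia.
rewrite mulr_sumr; apply: ler_sum_nat => k kn.
rewrite mulrCA mulr_suml; apply: ler_sum_seq => x; rewrite mem_E => /eqP xk.
rewrite ler_wpM2l ?invr_ge0 ?(ltW (rho_gt0 x)) //.
by have := @occurrences_le x (n - k); rewrite xk -subnDA addnn; apply; lia.
Qed.

Lemma inv_add_le (r u : rat) : 0 < r -> 0 < u ->
  (r^-1 + u^-1)^-1 + (r^-1 + u)^-1 <= (r + (u + u^-1)) / 4 + 7 / 20.
Proof.
move=> r0 u0; set t := u + u^-1.
have t2 : 2 <= t.
  rewrite -subr_ge0; have -> : t - 2 = (u - 1) ^+ 2 / u by rewrite /t; field; rewrite gt_eqF.
  by rewrite divr_ge0 ?sqr_ge0 // ltW.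
have D0 : 0 < r ^+ 2 + r * t + 1.
  have : 0 <= r * t by rewrite mulr_ge0; lra.
  by have := sqr_ge0 r; lra.
have -> : (r^-1 + u^-1)^-1 + (r^-1 + u)^-1 = r * (2 + r * t) / (r ^+ 2 + r * t + 1).
  rewrite /t; field.
  by rewrite !gt_eqF // !(addr_gt0, mulr_gt0, exprn_gt0).
rewrite ler_pdivrMr //.
suff : 4 * (r * (2 + r * t)) <= (r + t + 7 / 5) * (r ^+ 2 + r * t + 1) by lra.
have -> : t = 2 + (t - 2) by ring.
set v := t - 2; have v0 : 0 <= v by rewrite /v; lra.
have : 0 <= r * (r - 2 - v) ^+ 2 by rewrite mulr_ge0 ?sqr_ge0 // ltW.
have : 0 <= r * v by rewrite mulr_ge0 // ltW.
have : 0 <= (r - 9 / 5) ^+ 2 by rewrite sqr_ge0.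
have : 0 <= r * (r - 9 / 5) ^+ 2 by rewrite mulr_ge0 ?sqr_ge0 // ltW.
have : 0 <= r * v * v by rewrite !mulr_ge0 // ltW.
nra.
Qed.

Lemma mset_size_undup1 A : size (undup A) = 1%N -> exists x, A = nseq (size A) x :> seq T.
Proof.
case e: (undup A) => [|x [|]] // _; exists x; apply/all_pred1P/allP => y /=.
by rewrite -mem_undup e inE.
Qed.

Lemma pair_cond_le k l : (2 <= k)%N -> (2 <= l)%N ->
  \sum_(x <- E k) \sum_(A <- msets l) (cond (x +` A))^-1
  <= (S k * a l + a k * (S l + P l)) / 4 + 7 / 20 * (a k * a l).
Proof.
move=> k2 l2.
have -> : (S k * a l + a k * (S l + P l)) / 4 + 7 / 20 * (a k * a l)
    = \sum_(x <- E k) \sum_(y <- E l) ((rho x + (rho y + (rho y)^-1)) / 4 + 7 / 20).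
  transitivity (\sum_(x <- E k) ((rho x * a l + (S l + P l)) / 4 + 7 / 20 * a l)).
    rewrite big_split /= -mulr_suml big_split /= -mulr_suml !sumr_cst -/(a k) -/(S k).
    by ring.
  apply: eq_bigr => x _.
  by rewrite big_split /= -mulr_suml !big_split /= !sumr_cst -/(a l) -/(S l) -/(P l).
apply: ler_sum_seq => x xk; rewrite big_msets //; apply: ler_sum_seq => y yl.
rewrite !cond1D cond1 [cond (kids y)](esym (rho_kids _)) ?(wt_neq_leaf l2) //.
exact: inv_add_le (rho_gt0 x) (rho_gt0 y).
Qed.

Lemma with_leaf_conductance n : (2 <= n)%N ->
  \sum_(A <- msets n) (cond (leaf +` A))^-1 = a n.
Proof.
move=> n2; rewrite big_msets // card_of_wt_sum; apply: eq_big_seq => x /(wt_neq_leaf n2) xl.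
rewrite !cond1D cond1 [cond (kids x)](esym (rho_kids _)) // rho_leaf.
have := rho_gt0 x; set r := rho x => r0; field.
by rewrite !gt_eqF // !(addr_gt0, mulr_gt0, exprn_gt0).
Qed.

Definition constant_mset A : bool := size (undup A) == 1%N.

Lemma constant_conductance_le n :
  \sum_(A <- msets n | [&& (2 <= size A)%N, leaf \notin A & constant_mset A]) (cond A)^-1 / 2
  <= \sum_(2 <= k < n./2.+1) S k / 4.
Proof.
have -> : \sum_(2 <= k < n./2.+1) S k / 4 = \sum_(x <- wt_range 2 n./2.+1) rho x / 4.
  by rewrite big_allpairs_dep; apply: eq_bigr => k _; rewrite mulr_suml.
rewrite -big_filter.
have cst A : A \in [seq B : {mset T} <- msets n
                     | [&& (2 <= size B)%N, leaf \notin B & constant_mset B]] ->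
  [/\ A = nseq (size A) (head leaf A) :> seq T, (size A * wt (head leaf A))%N = n,
      head leaf A != leaf & (2 <= size A)%N].
  rewrite mem_filter mem_msets => /andP[/and3P[sA lA /eqP /mset_size_undup1[x eA]] /eqP wA].
  have eh : head leaf A = x by rewrite eA; case: (size A) sA.
  have xA : x \in A by rewrite -[x \in A]/(x \in enum_mset A) eA mem_nseq eqxx; case: (size A) sA.
  split; rewrite ?eh //; last by apply: contraNneq lA => <-.
  by rewrite -wA /mwt eA big_nseq size_nseq iter_addn_0 mulnC.
have hinj A B : (A : seq T) = nseq (size A) (head leaf A) ->
    (B : seq T) = nseq (size B) (head leaf B) -> (size A * wt (head leaf A))%N = n ->
    (size B * wt (head leaf B))%N = n -> head leaf A = head leaf B -> A = B.
  move=> eA eB wA wB e; rewrite -(seq_mset_id A) -(seq_mset_id B) eA eB e.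
  congr (seq_mset (nseq _ _)).
  by apply/eqP; rewrite -(eqn_pmul2r (wt_gt0 (head leaf A))) wA e wB.
have hrange A : (size A * wt (head leaf A))%N = n -> head leaf A != leaf ->
    (2 <= size A)%N -> head leaf A \in wt_range 2 n./2.+1.
  move=> wA; rewrite mem_wt_range -wt_eq1 => w1 sA.
  by have := wt_gt0 (head leaf A); nia.
have hle A : (A : seq T) = nseq (size A) (head leaf A) -> (2 <= size A)%N ->
    (cond A)^-1 / 2 <= rho (head leaf A) / 4.
  move=> eA sA; have := rho_gt0 (head leaf A); set r := rho _ => r0.
  have -> : cond A = r^-1 * (size A)%:R by rewrite /cond {1}eA big_nseq iter_addr_0 mulr_natr.
  have : 2 <= (size A)%:R :> rat by rewrite (ler_nat _ 2).
  set s := (size A)%:R => s2; rewrite invfM invrK -mulrA ler_pM2l // -invfM.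
  by rewrite lef_pV2 ?posrE; lra.
apply: (ler_sum_inj (h := fun A : {mset T} => head leaf A)).
- by rewrite filter_uniq ?uniq_msets.
- exact: uniq_wt_range.
- by move=> A B /cst[eA wA _ _] /cst[eB wB _ _]; apply: hinj.
- by move=> A /cst[_ wA lA sA]; apply: hrange.
- by move=> A /cst[eA _ _ sA]; apply: hle.
- by move=> x _; rewrite divr_ge0 // ltW ?rho_gt0.
Qed.

Lemma leafless_weights n A x : A \in msets n -> leaf \notin A -> (2 <= size A)%N ->
  x \in A -> (2 <= wt x < n.-1)%N.
Proof.
rewrite mem_msets => /eqP wA lA sA xA.
have w2 y : y \in A -> (2 <= wt y)%N.
  move=> yA; have := wt_gt0 y; have : wt y != 1%N by rewrite wt_eq1; apply: contraNneq lA => <-.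
  lia.
have [|y [B e]] := @mset_size_neq0P _ (A `\ x).
  by move: sA; rewrite -{1}(msetB1K xA) size_mset1D; lia.
have := w2 x xA; have := w2 y; rewrite -wA -(msetB1K xA) e !mwt1D mset1Dr ?mset1D1 //.
by move=> /(_ isT); lia.
Qed.

(* A leafless multiset with two distinct elements is pointed at least twice, so the sum
   over pointed multisets may be halved; the constant multisets are counted apart. *)
Lemma pointed_twice_le n A (g : rat) : A \in msets n -> 0 <= g ->
  (if (2 <= size A)%N && (leaf \notin A) then g else 0)
  <= \sum_(x <- undup A) (if (2 <= wt x < n.-1)%N then g / 2 else 0)
     + (if [&& (2 <= size A)%N, leaf \notin A & constant_mset A] then g / 2 else 0).
Proof.
move=> An g0; case: ifP => [/andP[sA lA]|_]; last first.
  by rewrite addr_ge0 ?sumr_ge0 // => [x _|]; case: ifP => // _; rewrite divr_ge0.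
have -> : \sum_(x <- undup A) (if (2 <= wt x < n.-1)%N then g / 2 else 0)
    = (size (undup A))%:R * (g / 2).
  rewrite -sumr_1 mulr_suml; apply: eq_big_seq => x; rewrite mem_undup => xA.
  by rewrite (leafless_weights An lA sA xA) mul1r.
rewrite sA lA /= /constant_mset; case: eqP => [->|ne]; first by rewrite mul1r; lra.
have : 2 <= (size (undup A))%:R :> rat.
  have : (size (undup A) != 0)%N.
    by apply: contraTneq sA => /eqP; rewrite size_eq0 => /eqP/undup_nil ->.
  by rewrite (ler_nat _ 2); lia.
by nra.
Qed.

Lemma parallel_sum_le_conv n : (3 <= n)%N ->
  P n <= a n.-1
    + \sum_(2 <= k < n.-1) ((S k * a (n - k) + a k * (S (n - k) + P (n - k))) / 4
                            + 7 / 20 * (a k * a (n - k))) / 2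
    + \sum_(2 <= k < n./2.+1) S k / 4.
Proof.
move=> n3; have n2 : (2 <= n)%N by lia.
pose G A := (cond A)^-1; have G0 A : 0 <= G A by rewrite invr_ge0 cond_ge0.
have -> : P n = \sum_(A <- msets n | (2 <= size A)%N) G A.
  rewrite big_msets_ge2 //; apply: eq_big_seq => x /(wt_neq_leaf n2) xl.
  by rewrite rho_kids.
rewrite (bigID (fun A : {mset T} => leaf \in A)) /= -addrA lerD //.
  rewrite -(@with_leaf_conductance n.-1); last by lia.
  have := big_msets_leaf G n.-1; rewrite prednK; last by lia.
  move=> <-; rewrite big_mkcond [leRHS]big_mkcond; apply: ler_sum => A _.
  by case: (_ \in A); rewrite ?andbF ?andbT //; case: ifP.
pose inner x := (2 <= wt x < n.-1)%N.
apply: (@le_trans _ _ (\sum_(A <- msets n) \sum_(x <- undup A) (if inner x then G A / 2 else 0)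
  + \sum_(A <- msets n | [&& (2 <= size A)%N, leaf \notin A & constant_mset A]) G A / 2)).
  rewrite big_mkcond [X in _ <= _ + X]big_mkcond -big_split /=.
  by apply: ler_sum_seq => A An; apply: pointed_twice_le.
rewrite lerD ?constant_conductance_le //.
rewrite (big_msets_pointed (fun x A => if inner x then G A / 2 else 0)).
have -> : \sum_(1 <= k < n.+1) \sum_(x <- E k) \sum_(A <- msets (n - k))
     (if inner x then G (x +` A) / 2 else 0)
   = \sum_(2 <= k < n.-1) \sum_(x <- E k) \sum_(A <- msets (n - k)) G (x +` A) / 2.
  rewrite [RHS](big_nat_widen _ _ n.+1); last by lia.
  rewrite [RHS](big_nat_widenl _ 1) //.
  rewrite [RHS]big_mkcond /=; apply: eq_bigr => k _.
  rewrite andbC; case: ifP => kn; last first.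
    rewrite big1_seq // => x /andP[_]; rewrite mem_E /inner => /eqP ->.
    by rewrite kn big1.
  by apply: eq_big_seq => x; rewrite mem_E /inner => /eqP ->; rewrite kn.
apply: ler_sum_nat => k kn.
under eq_bigr do rewrite -mulr_suml.
rewrite -mulr_suml ler_pM2r //; apply: pair_cond_le; lia.
Qed.

Lemma card_gt0 n : (1 <= n)%N -> 0 < a n.
Proof.
case: n => // n _; elim: n => [|n IH]; first by rewrite card1.
apply: lt_le_trans (@msets_card_le n.+1 isT).
case: n IH => [|n] IH; first by rewrite msets_card1.
by rewrite msets_cardE // mulr_gt0.
Qed.

Lemma resistance_total_bounds n : (2 <= n)%N ->
  2 * a n <= S n + P n <= 349 / 40 * a n.
Proof.
move=> n2; apply/andP; split.
  rewrite card_of_wt_sum mulr_sumr -big_split; apply: ler_sum => x _ /=.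
  have := rho_gt0 x; set r := rho x => r0.
  rewrite -subr_ge0; have -> : r + r^-1 - 2 * 1 = (r - 1) ^+ 2 / r by field; rewrite gt_eqF.
  by rewrite divr_ge0 ?sqr_ge0 // ltW.
have [hP hS] := resistance_sums_le card_ge0 card1 card2 msets_card0 msets_card1
  msets_cardE msets_card_le pointing_le parallel_sum1 series_sum_le parallel_sum_le
  series_sum_le_conv parallel_sum_le_conv n2.
lra.
Qed.

End MultisetTrees.

(** * Series circuits as trees *)

Section Trees.
Implicit Types (t u : tree) (s p : seq tree).

Lemma tree_nested_ind (Q : tree -> Prop) :
  (forall s p, (forall t, t \in s -> Q t) -> (forall t, t \in p -> Q t) -> Q (Pair s p)) ->
  forall t, Q t.
Proof.
move=> H; fix IH 1 => -[s p]; apply: H.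
  elim: s => [t ht|x s IHs t]; first discriminate ht.
  by rewrite inE => /orP[/eqP ->|/IHs].
elim: p => [t ht|x p IHp t]; first discriminate ht.
by rewrite inE => /orP[/eqP ->|/IHp].
Qed.

Fixpoint dual t : tree :=
  let: Pair s p := t in
  Pair (sort tree_le (map dual p)) (sort tree_le (map dual s)).

Lemma size_sort_dual s : size (sort tree_le (map dual s)) = size s.
Proof. by rewrite size_sort size_map. Qed.

Lemma dual_series_parallel t :
  (series_tree t -> parallel_tree (dual t)) /\ (parallel_tree t -> series_tree (dual t)).
Proof.
elim/tree_nested_ind: t => s p IHs IHp /=; rewrite /nilp !size_sort_dual.
have step (b c : pred tree) r : (forall t, t \in r -> b t -> c (dual t)) ->
    (size r == 0%N) || [&& (2 <= size r)%N, sorted tree_le r & all b r] ->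
    (size r == 0%N) || [&& (2 <= size r)%N, sorted tree_le (sort tree_le (map dual r))
                         & all c (sort tree_le (map dual r))].
  move=> bc /orP[->//|/and3P[-> _ al]]; apply/orP; right.
  rewrite (sort_sorted tree_le_total) all_sort all_map /=; apply/allP => t tr /=.
  exact: bc (allP al t tr).
split=> /andP[-> h]; rewrite ?andbT /=; apply: step h => t tr.
  by case: (IHs t tr).
by case: (IHp t tr).
Qed.

Lemma dual_series t : series_tree t -> parallel_tree (dual t).
Proof. by case: (dual_series_parallel t). Qed.

Lemma dual_parallel t : parallel_tree t -> series_tree (dual t).
Proof. by case: (dual_series_parallel t). Qed.

Lemma sort_dualK s : sorted tree_le s -> {in s, cancel dual dual} ->
  sort tree_le (map dual (sort tree_le (map dual s))) = s.
Proof.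
move=> so sK; apply: (sorted_eq tree_le_trans tree_le_anti) => //.
  exact: sort_sorted tree_le_total _.
rewrite perm_sort; apply: perm_trans (perm_map _ (permEl (perm_sort _ _))) _.
by rewrite -map_comp map_id_in.
Qed.

Lemma dualK t : series_tree t || parallel_tree t -> dual (dual t) = t.
Proof.
elim/tree_nested_ind: t => s p IHs IHp.
case/orP => /= /andP[/nilP -> /orP[/nilP -> //|/and3P[_ so al]]]; congr Pair.
  by apply: sort_dualK => // t ts; apply: (IHs t ts); rewrite (allP al t ts) orbT.
by apply: sort_dualK => // t ts; apply: (IHp t ts); rewrite (allP al t ts).
Qed.

Lemma tree_units_series s : (2 <= size s)%N ->
  tree_units (Pair s [::]) = (\sum_(t <- s) tree_units t)%N.
Proof. by case: s => // t s _; rewrite /= addn0 -[RHS](big_map tree_units xpredT id) -sumnE. Qed.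

Lemma tree_units_parallel s : (2 <= size s)%N ->
  tree_units (Pair [::] s) = (\sum_(t <- s) tree_units t)%N.
Proof. by case: s => // t s _; rewrite /= add0n -[RHS](big_map tree_units xpredT id) -sumnE. Qed.

Lemma tree_resistance_series s : (2 <= size s)%N ->
  tree_resistance (Pair s [::]) = \sum_(t <- s) tree_resistance t.
Proof. by case: s => // t s _; rewrite /= -[RHS](big_map tree_resistance xpredT id). Qed.

Lemma tree_resistance_parallel s : (2 <= size s)%N ->
  tree_resistance (Pair [::] s) = (\sum_(t <- s) (tree_resistance t)^-1)^-1.
Proof.
by case: s => // t s _; rewrite /= -[in RHS](big_map tree_resistance xpredT (fun y => y^-1)).
Qed.

Lemma big_sort_dual (R : Type) (idx : R) (op : Monoid.com_law idx) (f : tree -> R) s :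
  \big[op/idx]_(t <- sort tree_le (map dual s)) f t = \big[op/idx]_(t <- s) f (dual t).
Proof. by rewrite (perm_big _ (permEl (perm_sort _ _))) big_map. Qed.

Lemma units_dual t : series_tree t || parallel_tree t -> tree_units (dual t) = tree_units t.
Proof.
elim/tree_nested_ind: t => s p IHs IHp.
case/orP => /andP[/nilP -> /orP[/nilP -> //|/and3P[sz _ al]]].
  rewrite tree_units_series // [dual _]/= tree_units_parallel ?size_sort_dual //.
  rewrite big_sort_dual; apply: eq_big_seq => t ts; apply: (IHs t ts).
  by rewrite (allP (al : all parallel_tree s) t ts) orbT.
rewrite tree_units_parallel // [dual _]/= tree_units_series ?size_sort_dual //.
rewrite big_sort_dual; apply: eq_big_seq => t ts; apply: (IHp t ts).
by rewrite (allP (al : all series_tree p) t ts).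
Qed.

Lemma resistance_dual t : series_tree t || parallel_tree t ->
  tree_resistance (dual t) = (tree_resistance t)^-1.
Proof.
elim/tree_nested_ind: t => s p IHs IHp.
case/orP => /andP[/nilP -> /orP[/nilP ->|/and3P[sz _ al]]].
- by rewrite /= invr1.
- rewrite tree_resistance_series // [dual _]/= tree_resistance_parallel ?size_sort_dual //.
  rewrite big_sort_dual; congr (_^-1); apply: eq_big_seq => t ts.
  by rewrite (IHs t ts) ?invrK // (allP (al : all parallel_tree s) t ts) orbT.
- by rewrite /= invr1.
rewrite tree_resistance_parallel // [dual _]/= tree_resistance_series ?size_sort_dual //.
rewrite big_sort_dual invrK; apply: eq_big_seq => t ts.
by rewrite (IHp t ts) // (allP (al : all series_tree p) t ts).
Qed.

Lemma tree_units_gt0 t : (0 < tree_units t)%N.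
Proof.
elim/tree_nested_ind: t => -[|x s] [|y p] IHs IHp //=.
- by have := IHp y (mem_head _ _); lia.
- by have := IHs x (mem_head _ _); lia.
- by have := IHs x (mem_head _ _); lia.
Qed.

Definition stree : choiceType := {t : tree | series_tree t}.
Definition sleaf : stree := Sub (Pair [::] [::]) isT.
Definition sunits (x : stree) : nat := tree_units (val x).
Definition sres (x : stree) : rat := tree_resistance (val x).

(* The series tree with series components s is read as the multiset of the duals of s,
   which are series trees again. *)
Definition skids (x : stree) : {mset stree} :=
  let: Pair s _ := val x in seq_mset (pmap insub (map dual s)).

Lemma stree_val (x : stree) : exists2 s, val x = Pair s [::] &
  [/\ (s == [::]) || (2 <= size s)%N, sorted tree_le s & all parallel_tree s].
Proof.
move: (valP x); case: (val x) => s p /= /andP[/nilP -> h]; exists s => //.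
by case/orP: h => [/nilP ->|/and3P[-> -> ->]]; rewrite ?orbT.
Qed.

Lemma perm_skids (x : stree) s : val x = Pair s [::] ->
  perm_eq (map val (skids x)) (map dual s).
Proof.
move=> xs; have [s' xs' [_ _ al]] := stree_val x.
move: xs'; rewrite xs => -[e]; rewrite -e in al.
rewrite /skids xs; apply: perm_trans (perm_map _ (perm_eq_seq_mset _)) _.
rewrite (pmap_filter (@insubK _ _ _)) (eq_filter (a2 := series_tree)); last first.
  by move=> t; rewrite isSome_insub.
suff /all_filterP -> : all series_tree (map dual s) by [].
by rewrite all_map; apply: sub_all al => t; apply: dual_parallel.
Qed.

Lemma size_skids_val (x : stree) s : val x = Pair s [::] -> size (skids x) = size s.
Proof. by move=> /perm_skids/perm_size; rewrite !size_map. Qed.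

Lemma size_skids (x : stree) : (size (skids x) != 1)%N.
Proof.
have [s xs [h _ _]] := stree_val x; rewrite (size_skids_val xs).
by case: s h {xs} => [|? []].
Qed.

Lemma skids_inj : injective skids.
Proof.
move=> x y e; have [s xs [_ so al]] := stree_val x; have [s' ys [_ so' al']] := stree_val y.
apply: val_inj; rewrite xs ys; congr Pair.
apply: (sorted_eq tree_le_trans tree_le_anti) => //.
have : perm_eq (map dual s) (map dual s').
  by apply: perm_trans (perm_skids ys); rewrite perm_sym -e perm_skids.
move=> /(perm_map dual); rewrite -!map_comp !map_id_in // => t ts; apply: dualK.
  by rewrite (allP al' t ts) orbT.
by rewrite (allP al t ts) orbT.
Qed.

Lemma skids_surj (A : {mset stree}) : (size A != 1)%N -> exists x, skids x = A.
Proof.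
move=> sA; pose s := sort tree_le (map dual (map val A)).
have wf : series_tree (Pair s [::]).
  rewrite /= /nilp /s !size_sort !size_map sort_sorted; last exact: tree_le_total.
  rewrite all_sort all_map all_map /=; apply/orP.
  case e: (size A) sA => [|[|k]] // _; [by left|right].
  by apply/allP => x _ /=; apply: dual_series (valP x).
exists (Sub _ wf); rewrite -(seq_mset_id (skids _)) -[RHS]seq_mset_id; apply/eq_seq_msetP.
apply: (perm_map_inj (@val_inj _ _ stree)).
apply: perm_trans (perm_skids (SubK _ _)) _.
apply: perm_trans (perm_map _ (permEl (perm_sort _ _))) _.
rewrite -map_comp map_id_in // => t /mapP[x _ ->] /=; apply: dualK.
by rewrite (valP x).
Qed.

Lemma big_skids (R : Type) (idx : R) (op : Monoid.com_law idx) (f : tree -> R) (x : stree) s :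
  val x = Pair s [::] ->
  \big[op/idx]_(y <- skids x) f (val y) = \big[op/idx]_(t <- s) f (dual t).
Proof. by move=> h; rewrite -(big_map val xpredT f) (perm_big _ (perm_skids h)) big_map. Qed.

Lemma skids_leaf : skids sleaf = mset0.
Proof. by apply/eqP; rewrite -size_mset_eq0 (size_skids_val (s := [::])). Qed.

Lemma stree_neq_leaf (x : stree) s : val x = Pair s [::] -> x != sleaf ->
  [/\ (2 <= size s)%N, sorted tree_le s & all parallel_tree s].
Proof.
move=> xs xl; have [s' + [/orP[/eqP s0|h] so al]] := stree_val x; last first.
  by rewrite xs => -[->].
rewrite xs => -[e].
by case/negP: xl; apply/eqP/val_inj; rewrite xs e s0.
Qed.

Lemma sunits_gt0 (x : stree) : (0 < sunits x)%N.
Proof. exact: tree_units_gt0. Qed.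

Lemma sunits_kids (x : stree) : x != sleaf -> sunits x = (\sum_(y <- skids x) sunits y)%N.
Proof.
have [s xs _] := stree_val x => /(stree_neq_leaf xs)[sz _ al].
rewrite (big_skids _ _ xs) /sunits xs tree_units_series //.
by apply: eq_big_seq => t ts; rewrite units_dual // (allP al t ts) orbT.
Qed.

Lemma sres_kids (x : stree) : x != sleaf -> sres x = \sum_(y <- skids x) (sres y)^-1.
Proof.
have [s xs _] := stree_val x => /(stree_neq_leaf xs)[sz _ al].
rewrite (big_skids _ (fun t => (tree_resistance t)^-1) xs) /sres xs tree_resistance_series //.
by apply: eq_big_seq => t ts; rewrite resistance_dual ?invrK // (allP al t ts) orbT.
Qed.

Definition strees (n : nat) : seq stree := pmap insub (map val (fset_set (Gamma n) : seq circuit)).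

Lemma mem_Gamma n (c : circuit) : (c \in fset_set (Gamma n)) = (units c == n).
Proof.
rewrite in_fset_set; last exact: finite_Gamma.
by apply/idP/eqP => [|e]; [rewrite inE | apply/mem_set].
Qed.

Lemma uniq_strees n : uniq (strees n).
Proof. by rewrite pmap_sub_uniq // map_inj_uniq ?fset_uniq //; apply: val_inj. Qed.

Definition series_circuit (x : stree) : circuit :=
  Sub (val x) (introT orP (or_introl (valP x))).

Definition parallel_circuit (x : stree) : circuit :=
  Sub (dual (val x)) (introT orP (or_intror (dual_series (valP x)))).

Lemma mem_strees n x : (x \in strees n) = (sunits x == n).
Proof.
rewrite mem_pmap_sub; apply/mapP/eqP => [[c + e]|e].
  by rewrite mem_Gamma /units -e => /eqP.
by exists (series_circuit x); rewrite ?mem_Gamma // /units SubK -e.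
Qed.

Lemma circuit_cases (c : circuit) :
  (exists x, c = series_circuit x) \/ (exists x, c = parallel_circuit x).
Proof.
have /orP[sc|pc] := valP c; [left; exists (Sub _ sc)|right; exists (Sub _ (dual_parallel pc))].
  by apply: val_inj; rewrite SubK.
by apply: val_inj; rewrite /= dualK // pc orbT.
Qed.

End Trees.

Lemma stree_total_bounds n : (2 <= n)%N ->
  2 * (size (strees n))%:R <= \sum_(x <- strees n) sres x + \sum_(x <- strees n) (sres x)^-1
    <= 349 / 40 * (size (strees n))%:R.
Proof.
exact: (resistance_total_bounds skids_inj size_skids skids_surj skids_leaf sunits_gt0
  (erefl : sunits sleaf = 1%N) sunits_kids (erefl : sres sleaf = 1) sres_kids
  uniq_strees mem_strees).
Qed.

Lemma strees_gt0 n : (1 <= n)%N -> 0 < (size (strees n))%:R :> rat.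
Proof.
exact: (card_gt0 skids_inj size_skids skids_surj skids_leaf sunits_gt0
  (erefl : sunits sleaf = 1%N) sunits_kids uniq_strees mem_strees).
Qed.

Lemma resistance_parallel_circuit x : resistance (parallel_circuit x) = (sres x)^-1.
Proof. by rewrite /resistance /= resistance_dual // (valP x). Qed.

Lemma units_parallel_circuit x : units (parallel_circuit x) = sunits x.
Proof. by rewrite /units /= units_dual // (valP x). Qed.

Lemma dual_inj_stree : injective (fun x : stree => dual (val x)).
Proof.
move=> x y e; apply: val_inj; rewrite -[LHS]dualK ?(valP x) //.
by rewrite [dual (val x)]e dualK // (valP y).
Qed.

Lemma perm_Gamma n : (2 <= n)%N ->
  perm_eq (fset_set (Gamma n)) (map series_circuit (strees n) ++ map parallel_circuit (strees n)).
Proof.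
have injS : injective series_circuit by move=> x y /(congr1 val) e; apply/val_inj/e.
have injP : injective parallel_circuit by move=> x y /(congr1 val) e; apply/dual_inj_stree/e.
move=> n2; apply: uniq_perm; first exact: fset_uniq.
  rewrite cat_uniq !map_inj_uniq ?uniq_strees //= andbT.
  apply/hasPn => _ /mapP[y _ ->]; apply/mapP => -[x xn /(congr1 val) e].
  have [s xs _] := stree_val x.
  have : parallel_tree (dual (val y)) by rewrite dual_series // (valP y).
  rewrite [dual _](e : _ = val x) xs => /andP[/nilP s0 _].
  move: xn; rewrite mem_strees /sunits xs s0 /=.
  by case: n n2 => [|[]].
move=> c; rewrite mem_Gamma mem_cat; apply/eqP/orP => [cn|].
  have [[x ex]|[x ex]] := circuit_cases c; [left|right]; apply/mapP; exists x => //.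
    by rewrite mem_strees -cn ex.
  by rewrite mem_strees -cn ex units_parallel_circuit.
case=> /mapP[x + ->]; rewrite mem_strees => /eqP <- //.
by rewrite units_parallel_circuit.
Qed.

Lemma M1 : M 1 = 1.
Proof.
have e : fset_set (Gamma 1) = [fset series_circuit sleaf]%fset.
  apply/fsetP => c; rewrite mem_Gamma in_fset1; apply/eqP/eqP => [c1|->//].
  have leaf1 x : sunits x = 1%N -> x = sleaf.
    have wt1 := wt_eq1 skids_inj size_skids skids_leaf sunits_gt0 (erefl : sunits sleaf = 1%N).
    by move=> /eqP; rewrite (wt1 sunits_kids) => /eqP.
  have [[x ex]|[x ex]] := circuit_cases c; rewrite ex in c1 *.
    by rewrite (leaf1 x).
  by rewrite units_parallel_circuit in c1; rewrite (leaf1 x c1); apply: val_inj.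
by rewrite /M /R /Q e big_seq_fset1 cardfs1 divr1.
Qed.

Theorem mainTheorem2 (n : nat) (hn : (1 <= n)%N) :
  1 <= M n < 43954%:R / 10000%:R.
Proof.
have [n2|n2] := leqP 2 n; last first.
  have -> : n = 1%N by lia.
  by rewrite M1; apply/andP; split; lra.
have := stree_total_bounds n2; have := strees_gt0 hn.
have -> : M n = (\sum_(x <- strees n) sres x + \sum_(x <- strees n) (sres x)^-1)
                / (2 * (size (strees n))%:R).
  rewrite /M /R /Q; congr (_ / _).
    rewrite (perm_big _ (perm_Gamma n2)) big_cat !big_map; congr (_ + _).
    by apply: eq_bigr => x _; rewrite resistance_parallel_circuit.
  by rewrite (perm_size (perm_Gamma n2)) size_cat !size_map addnn -mul2n natrM.
set a := (size _)%:R; set s := _ + _ => a0 /andP[s1 s2].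
have a2 : 0 < 2 * a by lra.
by rewrite ler_pdivlMr // ltr_pdivrMr //; apply/andP; split; lra.
Qed.
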